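(* Let $b$ be a bus of the network, let $\delta\bm P(t)$ be an abrupt power loss at $b$, i.e. $\delta P_i(t)=\delta_{ib}\,\delta P\,\Theta(t)$, and let the damping ratio be homogeneous, $d_i/m_i=\gamma>0$ for all $i$. Let the inertias be weakly inhomogeneous, $m_i=m+\delta m\,r_i=m(1+\mu r_i)$ with $\mu=\delta m/m\ll 1$, $-1\le r_i\le 1$ and $\sum_i r_i=0$. Then, to leading (linear) order in $\mu$, the distribution of parameters $\{r_i\}$ that minimizes the performance measure $\mathcal M_b$ (that is, the minimizer of $\mathcal M_b^{(0)}+\sum_{i}\rho_i r_i$ over all $(r_i)$ with $|r_i|\le 1$ and $\sum_i r_i=0$) is obtained as follows. (1) Compute the sensitivities $\rho_i=\partial\mathcal M_b/\partial r_i$ from $$\rho_i=-\frac{\mu\,\delta P^2}{\gamma N}\sum_{\alpha>1}\frac{u^{(0)}_{\alpha b}u^{(0)}_{\alpha i}}{\lambda^{(0)}_\alpha}.$$ (2) Sort the set $\{\rho_i\}_{i=1,\dots,N}$ in ascending order (and relabel the buses accordingly). (3) In this ordering, set $r_i=1$ for $i=1,\dots,\lfloor N/2\rfloor$ and $r_i=-1$ for $i=N-\lfloor N/2\rfloor+1,\dots,N$ (if $N$ is odd, the remaining middle parameter is $r_i=0$). The optimal placement of inertia and primary control is then given by $m_i=m+\delta m\,r_i$ and $d_i=\gamma(m+\delta m\,r_i)$.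
   Context: Setting: a connected power grid with $N$ buses, bus $i$ having inertia $m_i>0$ and damping (primary control) $d_i$. Let $\bm M=\mathrm{diag}(m_i)$, $\bm D=\mathrm{diag}(d_i)$. Given line susceptances $B_{ij}$ and a stationary power flow solution $\theta_i^{(0)}$, the network Laplacian $\bm L$ has entries $L_{ij}=-B_{ij}\cos(\theta^{(0)}_i-\theta^{(0)}_j)$ for $i\neq j$ and $L_{ii}=\sum_k B_{ik}\cos(\theta^{(0)}_i-\theta^{(0)}_k)$; it is real symmetric with zero row sums, and its eigenvalues are $0=\lambda^{(0)}_1<\lambda^{(0)}_2<\dots<\lambda_N^{(0)}$ with orthonormal eigenvectors $\bm u^{(0)}_\alpha=(u^{(0)}_{\alpha i})_{i=1}^N$ (so $u^{(0)}_{1i}=1/\sqrt N$). The linearized dynamics of the angle deviations $\delta\bm\theta$ and frequencies $\bm\omega=\dot{\delta\bm\theta}$ is $$\bm M\dot{\bm\omega}+\bm D\bm\omega=\delta\bm P(t)-\bm L\,\delta\bm\theta,$$ started from the stationary state, $\delta\bm\theta(0)=\bm\omega(0)=0$. $\Theta$ is the Heaviside step function ($\Theta(t)=1$ for $t>0$, $0$ for $t<0$) and $\delta_{ib}$ is the Kronecker symbol. Performance measure: $\mathcal M_b=\int_0^\infty(\bm\omega-\bar{\bm\omega})^\top\bm M(\bm\omega-\bar{\bm\omega})\,dt$ for the abrupt power loss $\delta P_i(t)=\delta_{ib}\,\delta P\,\Theta(t)$ at bus $b$, where all components of $\bar{\bm\omega}$ equal $\omega_{\rm sys}(t)=\sum_i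 m_i\omega_i(t)/\sum_i m_i$. $\mathcal M_b^{(0)}$ denotes its value for homogeneous inertia ($r_i=0$ for all $i$), and $\mathcal M_b=\mathcal M_b^{(0)}+\sum_i\rho_i r_i+\mathcal O(\mu^2)$; that is, $\rho_i=\partial\mathcal M_b/\partial r_i$ denotes the sensitivity to first order in $\mu$. *)

(* Defs.v *)
From HB Require Import structures.
From mathcomp Require Import all_boot all_order all_algebra all_fingroup.
From mathcomp Require Import all_classical all_reals all_analysis.

Set Implicit Arguments.
Unset Strict Implicit.
Unset Printing Implicit Defensive.

Import Order.TTheory GRing.Theory Num.Theory.
Import numFieldNormedType.Exports.

Local Open Scope classical_set_scope.
Local Open Scope ring_scope.

(* Buses are indexed by 'I_N (from 0). Bus parameters (inertia, damping, r) are
   row vectors; dynamical states (angles, frequencies, powers) are columns. *)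

(* Lossless lines: [P0] are the injections balanced by the angles [th0]. The
   diagonal of [B] vanishes, so that the sum over all k in the diagonal entries
   of the Laplacian gives zero row sums. *)
Record stationary_grid (R : realType) (N : nat)
    (B : 'M[R]_N) (P0 th0 : 'cV[R]_N) : Prop := StationaryGrid {
  susceptance_sym : forall i j, B i j = B j i;
  susceptance_diag : forall i, B i i = 0;
  grid_connected : forall i j, connect (fun k l : 'I_N => B k l != 0) i j;
  power_flow : forall i,
    P0 i 0 = \sum_j B i j * sin (th0 i 0 - th0 j 0)
}.

Definition laplacian (R : realType) (N : nat) (B : 'M[R]_N) (th0 : 'cV[R]_N) :
    'M[R]_N :=
  \matrix_(i, j)
    if i == j then \sum_k B i k * cos (th0 i 0 - th0 k 0)
    else - (B i j * cos (th0 i 0 - th0 j 0)).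

(* The index 0 of ['I_N] is the zero mode, usually numbered alpha = 1. *)
Record laplacian_spectrum (R : realType) (N : nat) (L : 'M[R]_N)
    (lam : 'I_N -> R) (u : 'I_N -> 'cV[R]_N) : Prop := LaplacianSpectrum {
  spectrum_eigen : forall a, L *m u a = lam a *: u a;
  spectrum_orthonormal : forall a c,
    \sum_i u a i 0 * u c i 0 = (a == c)%:R;
  spectrum_zero : forall a : 'I_N, nat_of_ord a = 0%N -> lam a = 0;
  spectrum_increasing : forall a c : 'I_N, (a < c)%N -> lam a < lam c
}.

(* The value at t = 0 is immaterial: the dynamics is only imposed for t > 0. *)
Definition heaviside (R : realType) (t : R) : R := if 0 < t then 1 else 0.

Definition power_loss (R : realType) (N : nat) (b : 'I_N) (dP : R) (t : R) :
    'cV[R]_N :=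
  \col_i ((i == b)%:R * dP * heaviside t).

(* As the forcing jumps at t = 0, the solution is required to be continuous on
   [0, +oo[ and differentiable on ]0, +oo[. *)
Record swing_solution (R : realType) (N : nat) (mass damp : 'rV[R]_N)
    (L : 'M[R]_N) (dPt th om : R -> 'cV[R]_N) : Prop := SwingSolution {
  swing_th0 : th 0 = 0;
  swing_om0 : om 0 = 0;
  swing_th_cont : {within `[0, +oo[, continuous th};
  swing_om_cont : {within `[0, +oo[, continuous om};
  swing_th_deriv : forall t : R, 0 < t -> is_derive t 1 th (om t);
  swing_om_derivable : forall t : R, 0 < t -> derivable om t 1;
  swing_eq : forall t : R, 0 < t ->
    diag_mx mass *m 'D_1 om t + diag_mx damp *m om t = dPt t - L *m th t
}.

Definition omega_sys (R : realType) (N : nat) (mass : 'rV[R]_N)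
    (w : 'cV[R]_N) : R :=
  (\sum_i mass 0 i * w i 0) / \sum_i mass 0 i.

Definition freq_deviation (R : realType) (N : nat) (mass : 'rV[R]_N)
    (w : 'cV[R]_N) : 'cV[R]_N := w - const_mx (omega_sys mass w).

Definition perf_measure (R : realType) (N : nat) (mass : 'rV[R]_N)
    (om : R -> 'cV[R]_N) : \bar R :=
  (\int[lebesgue_measure]_(t in `[0%R, +oo[)
     (((freq_deviation mass (om t))^T *m diag_mx mass *m
       freq_deviation mass (om t)) 0%R 0%R)%:E)%E.

Definition feasible_parameters (R : realType) (N : nat) (gam : R)
    (mass damp : 'rV[R]_N) : Prop :=
  (forall i, 0 < mass 0 i) /\ (forall i, damp 0 i / mass 0 i = gam).

Definition inertia (R : realType) (N : nat) (m dm : R) (r : 'rV[R]_N) :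
    'rV[R]_N := \row_i (m + dm * r 0 i).

Definition damping (R : realType) (N : nat) (gam m dm : R) (r : 'rV[R]_N) :
    'rV[R]_N := \row_i (gam * (m + dm * r 0 i)).

(* [om mass damp] is the frequency trajectory of the grid with inertias [mass]
   and damping coefficients [damp]. *)
Definition Mb (R : realType) (N : nat)
    (om : 'rV[R]_N -> 'rV[R]_N -> R -> 'cV[R]_N)
    (gam m dm : R) (r : 'rV[R]_N) : \bar R :=
  perf_measure (inertia m dm r) (om (inertia m dm r) (damping gam m dm r)).

Definition admissible (R : realType) (N : nat) (r : 'rV[R]_N) : Prop :=
  (forall i, -1 <= r 0 i <= 1) /\ \sum_i r 0 i = 0.

Definition sensitivity (R : realType) (N : nat) (lam : 'I_N -> R)
    (u : 'I_N -> 'cV[R]_N) (b : 'I_N) (dP gam mu : R) (i : 'I_N) : R :=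
  - (mu * dP ^+ 2 / (gam * N%:R)) *
    \sum_(a < N | (0 < a)%N) u a b 0 * u a i 0 / lam a.

Definition linear_measure (R : realType) (N : nat) (M0 : R) (rho : 'I_N -> R)
    (r : 'rV[R]_N) : R :=
  M0 + \sum_i rho i * r 0 i.

Definition is_minimizer (R : realType) (T : Type) (A : T -> Prop) (f : T -> R)
    (x : T) : Prop :=
  A x /\ forall y, A y -> f x <= f y.

(* [s k] is the bus of rank [k] (from 0) once the buses are relabelled. *)
Definition sorts_ascending (R : realType) (N : nat) (rho : 'I_N -> R)
    (s : 'S_N) : Prop :=
  forall k l : 'I_N, (k <= l)%N -> rho (s k) <= rho (s l).

Definition sorted_placement (R : realType) (N : nat) (s : 'S_N) : 'rV[R]_N :=
  \row_i (let k := (s^-1)%g i in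
          if (k < N./2)%N then 1
          else if (N - N./2 <= k)%N then -1 else 0).

(* Main.v *)
(* With homogeneous damping ratio, [M_b] has a closed form. Subtracting the
   inertia-weighted mean and the new equilibrium leaves an unforced damped
   oscillator [M x'' + gam M x' + L x = 0] with [x'(0) = 0]. Its energy decreases
   at rate [gam x'^T M x'] and tends to 0, so the integral of [x'^T M x'] is
   [x(0)^T L x(0) / (2 gam)]. In terms of the pseudo-inverse [G] of the Laplacian
   this reads [M_b = dP^2 / (2 gam) * (e_b - a)^T G (e_b - a)], where [a] is the
   vector of inertias divided by their sum; as [G] kills the constant vectors,
   [M_b] is an explicit function of [r], from which the derivative and the
   quadratic remainder are read off. *)
Require Import Defs.
From HB Require Import structures.
From mathcomp Require Import all_boot all_order all_algebra all_fingroup.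
From mathcomp Require Import all_classical all_reals all_analysis.
From mathcomp Require Import ring lra zify.

Import Order.TTheory GRing.Theory Num.Theory.
Import numFieldNormedType.Exports.

Local Open Scope classical_set_scope.
Local Open Scope ring_scope.

(** * Bilinear forms given by matrices: algebra, limits and derivatives *)

Definition bform {R : realType} {n : nat} (A : 'M[R]_n) (p q : 'cV[R]_n) : R :=
  (p^T *m A *m q) 0 0.

Section bilinear_form.
Context {R : realType} {n : nat}.
Implicit Types (A : 'M[R]_n) (p q : 'cV[R]_n) (a : R).

Lemma bformE A p q : bform A p q = \sum_i p i 0 * (A *m q) i 0.
Proof.
by rewrite /bform -mulmxA mxE; apply: eq_bigr => i _; rewrite mxE.
Qed.

Lemma bformEr {A B p} q : A *m p = B -> bform A q p = (q^T *m B) 0 0.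
Proof. by move=> <-; rewrite /bform mulmxA. Qed.

Lemma bformDl A p1 p2 q : bform A (p1 + p2) q = bform A p1 q + bform A p2 q.
Proof. by rewrite /bform linearD /= !mulmxDl mxE. Qed.

Lemma bformDr A p q1 q2 : bform A p (q1 + q2) = bform A p q1 + bform A p q2.
Proof. by rewrite /bform mulmxDr mxE. Qed.

Lemma bformZl A a p q : bform A (a *: p) q = a * bform A p q.
Proof. by rewrite /bform linearZ /= -!scalemxAl mxE. Qed.

Lemma bformZr A a p q : bform A p (a *: q) = a * bform A p q.
Proof. by rewrite /bform -scalemxAr mxE. Qed.

Lemma bform_sym {A} p q : A^T = A -> bform A p q = bform A q p.
Proof.
move=> AT; rewrite /bform -[LHS]trace_mx11 -mxtrace_tr !trmx_mul trmxK AT.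
by rewrite trace_mx11 mulmxA.
Qed.

(** The matrix norm is the maximum over finitely many entries, so finitely many scalar estimates can
    be met simultaneously. *)
Lemma cvg_coord {T : Type} {F : set_system T} {FF : Filter F} {m}
    {f : T -> 'cV[R]_m} {p : 'cV[R]_m} :
  f x @[x --> F] --> p <-> forall i, f x i 0 @[x --> F] --> p i 0.
Proof.
split=> [fp i|fp].
  by apply: (cvg_comp _ (fun M : 'cV[R]_m => M i 0) fp); exact: coord_continuous.
apply/cvgrPdist_le => /= e e0; near=> x.
rewrite /Num.Def.normr/= mx_normrE (bigmax_le _ (ltW e0))//= => -[i k] _.
rewrite ord1 !mxE /=; move: i; near: x; apply: filter_forall => /= i.
exact: ((cvgrPdist_le _ _).1 (fp i)).
Unshelve. all: by end_near. Qed.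

Lemma cvg_mulmx {T : Type} {F : set_system T} {FF : Filter F} {m}
    (A : 'M[R]_(m, n)) {f : T -> 'cV[R]_n} {p} :
  f x @[x --> F] --> p -> A *m f x @[x --> F] --> A *m p.
Proof.
move=> /cvg_coord fp; apply/cvg_coord => i; rewrite mxE.
under eq_fun do rewrite mxE.
by apply: cvg_big => [|j _]; [exact: add_continuous|apply: cvgM => //; exact: cvg_cst].
Qed.

Lemma cvg_bform {T : Type} {F : set_system T} {FF : Filter F} {A}
    {f g : T -> 'cV[R]_n} {p q} :
  f x @[x --> F] --> p -> g x @[x --> F] --> q ->
  bform A (f x) (g x) @[x --> F] --> bform A p q.
Proof.
move=> /cvg_coord fp /(cvg_mulmx A)/cvg_coord gq.
rewrite bformE; under eq_fun do rewrite bformE.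
by apply: cvg_big => [|i _]; [exact: add_continuous|exact: cvgM].
Qed.

Lemma is_derive_coord {m} {f : R -> 'cV[R]_m} {t : R} {df} :
  is_derive t 1 f df <-> forall i, is_derive t 1 (fun s => f s i 0) (df i 0).
Proof.
split=> [[fd <-] i|H].
  have := derive_mx fd => ->; rewrite mxE; apply: DeriveDef => //.
  by move/derivable_mxP : fd; exact.
have fd : derivable f t 1.
  by apply/derivable_mxP => i j; rewrite ord1; case: (H i).
apply: DeriveDef => //; rewrite derive_mx //; apply/colP => i; rewrite mxE.
by case: (H i).
Qed.

Lemma is_derive_mulmx {m} (A : 'M[R]_(m, n)) {f : R -> 'cV[R]_n} {t : R} {df} :
  is_derive t 1 f df -> is_derive t 1 (fun s => A *m f s) (A *m df).
Proof.
move=> /is_derive_coord fd; apply/is_derive_coord => i.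
have -> : (fun s => (A *m f s) i 0) = \sum_j (A i j *: (fun s => f s j 0)).
  by apply/funext => s; rewrite mxE fct_sumE.
rewrite mxE; apply: is_derive_sum => j; apply: is_deriveZ.
Qed.

Lemma is_derive_bform A {f g : R -> 'cV[R]_n} {t : R} {df dg} :
  is_derive t 1 f df -> is_derive t 1 g dg ->
  is_derive t 1 (fun s => bform A (f s) (g s))
    (bform A df (g t) + bform A (f t) dg).
Proof.
move=> /is_derive_coord fd /(is_derive_mulmx A)/is_derive_coord gd.
have -> : (fun s => bform A (f s) (g s)) =
    \sum_i ((fun s => f s i 0) * (fun s => (A *m g s) i 0)).
  by apply/funext => s; rewrite bformE fct_sumE.
rewrite !bformE -big_split /=; apply: is_derive_sum => i.
have := is_deriveM (fd i) (gd i) => H; apply: is_derive_eq.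
by rewrite addrC; congr (_ + _); rewrite [LHS]mulrC.
Qed.

End bilinear_form.

(** * Energy decay and dissipation integral of an unforced damped oscillator *)

Section damped_oscillator.
Context {R : realType} {n : nat} (M L : 'M[R]_n) (gam : R).
Variables x v w : R -> 'cV[R]_n.
Hypotheses (gam_gt0 : 0 < gam) (M_sym : M^T = M) (L_sym : L^T = L).
Hypotheses (M_ge0 : forall p, 0 <= bform M p p)
  (L_ge0 : forall p, 0 <= bform L p p).
Hypotheses (v0 : v 0 = 0) (x_cont : {within `[0, +oo[, continuous x})
  (v_cont : {within `[0, +oo[, continuous v}).
Hypotheses (x_deriv : forall t : R, 0 < t -> is_derive t 1 x (v t))
  (v_deriv : forall t : R, 0 < t -> is_derive t 1 v (w t)).
Hypothesis motion : forall t : R, 0 < t ->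
  M *m w t = - (gam *: (M *m v t)) - L *m x t.

Let energy t := 2^-1 * (bform M (v t) (v t) + bform L (x t) (x t)).
(** The second term cancels the friction part of the derivative of the first; what remains is twice
    the kinetic minus twice the potential energy. *)
Let virial t := bform M (x t) (v t) + gam / 2 * bform M (x t) (x t).
(* The last two terms have derivative [- energy t], so [lyapunov] decreases along
   with the energy; since it bounds [t * energy t], the energy is O(1/t). *)
Let lyapunov t := t * energy t + gam^-1 * energy t + 2^-1 * virial t.

Let within_bform A (f g : R -> 'cV[R]_n) :
  {within `[0, +oo[, continuous f} -> {within `[0, +oo[, continuous g} ->
  {within `[0, +oo[, continuous (fun t => bform A (f t) (g t))}.
Proof. by move=> fc gc t; apply: cvg_bform; [exact: fc|exact: gc]. Qed.

(** The acceleration enters the derivatives below only paired with [M], so this identity always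
    eliminates it. *)
Let bformMw p t : 0 < t ->
  bform M p (w t) = - gam * bform M p (v t) - bform L p (x t).
Proof.
move=> t0; rewrite (bformEr p (motion t t0)) mulmxBr mulmxN -scalemxAr.
rewrite /bform -!mulmxA; move: (_ *m _) (_ *m _) => a b.
by rewrite !mxE mulNr.
Qed.

Let energy_deriv (t : R) : 0 < t ->
  is_derive t 1 energy (- gam * bform M (v t) (v t)).
Proof.
move=> t0.
have dv := is_derive_bform M (v_deriv t t0) (v_deriv t t0).
have dx := is_derive_bform L (x_deriv t t0) (x_deriv t t0).
have := is_deriveZ 2^-1 (is_deriveD dv dx) => H.
apply: (@is_derive_eq _ _ _ _ _ _ _ _ H).
rewrite (bform_sym (w t) _ M_sym) (bform_sym (v t) (x t) L_sym) !bformMw //.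
rewrite (bform_sym (v t) (x t) L_sym) /GRing.scale/=; by field.
Qed.

Let virial_deriv (t : R) : 0 < t ->
  is_derive t 1 virial (bform M (v t) (v t) - bform L (x t) (x t)).
Proof.
move=> t0.
have d1 := is_derive_bform M (x_deriv t t0) (v_deriv t t0).
have d2 := is_derive_bform M (x_deriv t t0) (x_deriv t t0).
have := is_deriveD d1 (is_deriveZ (gam / 2) d2) => H.
apply: (@is_derive_eq _ _ _ _ _ _ _ _ H).
rewrite bformMw // (bform_sym (v t) (x t) M_sym) /GRing.scale/=; by field.
Qed.

Let lyapunov_deriv (t : R) : 0 < t ->
  is_derive t 1 lyapunov (- gam * t * bform M (v t) (v t)).
Proof.
move=> t0; have dE := energy_deriv t t0.
have := is_deriveD (is_deriveD (is_deriveM (is_derive_id t 1) dE)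
  (is_deriveZ gam^-1 dE)) (is_deriveZ 2^-1 (virial_deriv t t0)) => H.
apply: (@is_derive_eq _ _ _ _ _ _ _ _ H).
by rewrite /GRing.scale/= /energy; field; rewrite gt_eqF.
Qed.

Let energy_cont : {within `[0, +oo[, continuous energy}.
Proof.
move=> t; apply: cvgM; first exact: cvg_cst.
by apply: cvgD; exact: within_bform.
Qed.

Let lyapunov_cont : {within `[0, +oo[, continuous lyapunov}.
Proof.
move=> t; apply: cvgD; last first.
  apply: cvgM; first exact: cvg_cst.
  apply: cvgD; first exact: within_bform.
  by apply: cvgM; [exact: cvg_cst|exact: within_bform].
apply: cvgD; apply: cvgM; try exact: energy_cont; last exact: cvg_cst.
by apply: (@continuous_subspaceT _ _ _ (@idfun R)) => s; exact: cvg_id.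
Qed.

Let energy_ge0 t : 0 <= energy t.
Proof. by rewrite mulr_ge0 ?invr_ge0 ?addr_ge0. Qed.

(* Completing the square leaves only nonnegative terms next to [t * energy t]. *)
Let energy_le_lyapunov t : t * energy t <= lyapunov t.
Proof.
rewrite /lyapunov -addrA lerDl.
have -> : gam^-1 * energy t + 2^-1 * virial t =
    (4 * gam)^-1 * (bform M (v t + gam *: x t) (v t + gam *: x t) +
      bform M (v t) (v t)) + (2 * gam)^-1 * bform L (x t) (x t).
  rewrite !(bformDl, bformDr, bformZl, bformZr) (bform_sym (v t) (x t) M_sym).
  by rewrite /energy /virial; field; rewrite gt_eqF.
by rewrite addr_ge0 ?mulr_ge0 ?addr_ge0 ?invr_ge0 ?mulr_ge0 // ltW.
Qed.

Let energy_cvg0 : energy t @[t --> +oo] --> 0.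
Proof.
have bound t : 0 < t -> energy t <= lyapunov 0 / t.
  move=> t0; rewrite ler_pdivlMr // mulrC (le_trans (energy_le_lyapunov t)) //.
  apply: (ler0_derive1_nincry (a := 0)) => //; last exact: ltW.
    by move=> s; rewrite in_itv /= andbT => /lyapunov_deriv [ld _].
  move=> s; rewrite in_itv /= andbT => s0.
  have dl := lyapunov_deriv s s0.
  rewrite derive1E derive_val !mulNr oppr_le0 mulr_ge0 //.
  by rewrite mulr_ge0 // ltW.
apply: (@squeeze_cvgr _ _ _ _ (fun=> 0) (fun t => lyapunov 0 / t)).
- near=> t; rewrite energy_ge0 bound //.
- exact: cvg_cst.
- rewrite -[X in _ --> X](mulr0 (lyapunov 0)).
  apply: cvgM; first exact: cvg_cst.
  by apply/gtr0_cvgV0; [exact: nbhs_pinfty_gt|exact: cvg_id].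
Unshelve. all: by end_near. Qed.

Lemma integral_damped :
  (\int[lebesgue_measure]_(t in `[0%R, +oo[) (bform M (v t) (v t))%:E =
    (bform L (x 0) (x 0) / (2 * gam))%:E)%E.
Proof.
have E0 : energy 0 = 2^-1 * bform L (x 0) (x 0).
  by rewrite /energy v0 /bform mulmx0 mxE add0r.
(* By [energy_deriv], [- gam^-1 * energy] is an antiderivative of the nonnegative integrand; it
   tends to 0, and its value at 0 is purely potential since [v 0 = 0]. *)
rewrite (@ge0_continuous_FTC2y _ _ (fun t => - gam^-1 * energy t) _ 0) //.
- rewrite E0 sub0e -EFinN; congr EFin; by field; rewrite gt_eqF.
- exact: within_bform.
- rewrite -[X in _ --> X](mulr0 (- gam^-1)).
  by apply: cvgM => //; exact: cvg_cst.
- by move=> t /energy_deriv [dE _]; apply: derivableM; first exact: derivable_cst.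
- apply: cvgM; first exact: cvg_cst.
  by move/continuous_within_itvcyP : energy_cont => [].
- move=> t; rewrite in_itv /= andbT => t0; have dE := energy_deriv t t0.
  rewrite derive1E deriveZ // derive_val /GRing.scale/=.
  by field; rewrite gt_eqF.
Qed.

End damped_oscillator.

(** * Reduction of the swing equation to the damped oscillator *)

Section swing_centering.
Context {R : realType} {N : nat} (mass : 'rV[R]_N).
Hypothesis mass_gt0 : forall i, 0 < mass 0 i.

Let one : 'cV[R]_N := const_mx 1.
Let total := \sum_i mass 0 i.

(** These two matrices are transposes of each other: the first removes the inertia-weighted mean of
    a state, the second removes the total of a force, spread over the buses in proportion to their
    inertia. *)
Definition state_centering : 'M[R]_N := 1%:M - total^-1 *: (one *m mass).
Definition force_centering : 'M[R]_N := 1%:M - total^-1 *: (mass^T *m one^T).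

Lemma freq_deviationE w : freq_deviation mass w = state_centering *m w.
Proof.
rewrite mulmxBl mul1mx -scalemxAl -mulmxA /freq_deviation; congr (_ - _).
apply/colP => i; rewrite !mxE big_ord1 !mxE mul1r mulrC.
by congr (_ * _); apply: eq_bigr.
Qed.

Let diag_one : diag_mx mass *m one = mass^T.
Proof. by apply/colP => i; rewrite mul_diag_mx !mxE mulr1. Qed.

Let one_diag : one^T *m diag_mx mass = mass.
Proof. by rewrite -[LHS]trmxK trmx_mul tr_diag_mx trmxK diag_one trmxK. Qed.

(** Both sides are the mass matrix minus [total^-1 *: (mass^T *m mass)]. Centring the states thus
    amounts to centring the forces in the swing equation. *)
Lemma diag_state_centering :
  diag_mx mass *m state_centering = force_centering *m diag_mx mass.
Proof.
rewrite mulmxBr mulmxBl mulmx1 mul1mx -scalemxAr -scalemxAl.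
by rewrite mulmxA diag_one -mulmxA one_diag.
Qed.

(** A force of zero sum is one that the Laplacian can balance; this is what gives the centred system
    an equilibrium. *)
Lemma one_force_centering : 0 < total -> one^T *m force_centering = 0.
Proof.
move=> total0; rewrite mulmxBr mulmx1 -scalemxAr mulmxA.
have -> : one^T *m mass^T = total%:M.
  apply/matrixP => i j; rewrite !ord1 !mxE /= mulr1n.
  by apply: eq_bigr => k _; rewrite !mxE mul1r.
by rewrite mul_scalar_mx scalerA mulVf ?gt_eqF // scale1r subrr.
Qed.

Lemma bform_diag_ge0 p : 0 <= bform (diag_mx mass) p p.
Proof.
rewrite bformE sumr_ge0 // => i _.
by rewrite mul_diag_mx mxE mulrCA mulr_ge0 ?sqr_ge0 ?ltW.
Qed.

(** Any [w] balancing the centred unit injection serves: two choices differ by a kernel vector of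
    [L], which [bform L w w] ignores. The pseudo-inverse later supplies one. *)
Lemma perf_measure_swing (gam dP : R) (b : 'I_N) (L : 'M[R]_N)
    (damp : 'rV[R]_N) (th om : R -> 'cV[R]_N) (w : 'cV[R]_N) :
  0 < gam -> damp = gam *: mass -> L^T = L -> (forall p, 0 <= bform L p p) ->
  L *m one = 0 -> L *m w = force_centering *m delta_mx b 0 ->
  swing_solution mass damp L (power_loss b dP) th om ->
  perf_measure mass om = (dP ^+ 2 * bform L w w / (2 * gam))%:E.
Proof.
move=> gam0 dampE L_sym L_ge0 L1 Lw [th0 om0 thc omc thd omd sw].
have oneL : one^T *m L = 0 by rewrite -[LHS]trmxK trmx_mul trmxK L_sym L1 trmx0.
(* Measured from the equilibrium [dP *: w], the centred angles obey an unforced equation. *)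
pose x t := state_centering *m th t - dP *: w.
pose v t := state_centering *m om t.
have dom (t : R) : 0 < t -> is_derive t 1 om ('D_1 om t).
  by move=> t0; apply: DeriveDef => //; exact: omd.
have xd (t : R) : 0 < t -> is_derive t 1 x (v t).
  move=> t0; have thd' := is_derive_mulmx state_centering (thd t t0).
  have := is_deriveB thd' (is_derive_cst (dP *: w) (t : R) 1) => H.
  by apply: (@is_derive_eq _ _ _ _ _ _ _ _ H); rewrite subr0.
have vd (t : R) : 0 < t -> is_derive t 1 v (state_centering *m 'D_1 om t).
  by move=> t0; apply: is_derive_mulmx; exact: dom.
transitivity
  (\int[lebesgue_measure]_(t in `[0%R, +oo[)
     (bform (diag_mx mass) (v t) (v t))%:E)%E.
  by apply: eq_integral => t _; rewrite freq_deviationE.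
rewrite (integral_damped (diag_mx mass) L gam x v _ gam0 _ L_sym _ L_ge0 _
  _ _ xd vd) //.
- rewrite /x th0 mulmx0 sub0r -scaleNr bformZl bformZr mulrA mulrNN -expr2 //.
- by rewrite tr_diag_mx.
- exact: bform_diag_ge0.
- by rewrite /v om0 mulmx0.
- move=> t; apply: cvgB; last exact: cvg_cst.
  by apply: cvg_mulmx; exact: thc.
- by move=> t; apply: cvg_mulmx; exact: omc.
- move=> t t0; rewrite /v /x.
  rewrite !mulmxA diag_state_centering -!mulmxA.
  (* The homogeneous damping ratio turns the damping matrix into [gam] times the mass matrix, so
     centring passes through the damping term as well. *)
  have -> : diag_mx mass *m 'D_1 om t =
      power_loss b dP t - L *m th t - gam *: (diag_mx mass *m om t).
    by rewrite -(sw t t0) dampE linearZ -scalemxAl addrK.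
  have -> : power_loss b dP t = dP *: delta_mx b 0.
    by apply/colP => i; rewrite !mxE /heaviside t0 mulr1 eqxx andbT mulrC.
  rewrite !mulmxBr -!scalemxAr -Lw.
  (* Since [L] has zero row and column sums, neither centring changes the restoring force. *)
  have -> : force_centering *m (L *m th t) = L *m th t.
    by rewrite mulmxA mulmxBl mul1mx -scalemxAl -mulmxA oneL mulmx0 scaler0 subr0.
  have -> : L *m (state_centering *m th t) = L *m th t.
    by rewrite mulmxA mulmxBr mulmx1 -scalemxAr mulmxA L1 mul0mx scaler0 subr0.
  by rewrite addrC opprB.
Qed.

End swing_centering.

(** * Symmetry and zero row sums of the Laplacian *)

Lemma laplacian_sym (R : realType) (N : nat) (B : 'M[R]_N) (P0 th0 : 'cV[R]_N) :
  stationary_grid B P0 th0 -> (laplacian B th0)^T = laplacian B th0.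
Proof.
move=> [symB _ _ _]; apply/matrixP => i j; rewrite !mxE eq_sym.
have [->//|_] := eqVneq i j.
by rewrite symB -cosN opprB.
Qed.

Lemma laplacian_const (R : realType) (N : nat) (B : 'M[R]_N)
    (P0 th0 : 'cV[R]_N) :
  stationary_grid B P0 th0 -> laplacian B th0 *m const_mx 1 = 0 :> 'cV[R]_N.
Proof.
move=> [_ B0 _ _]; apply/colP => i; rewrite !mxE (bigD1 i) //= !mxE eqxx mulr1.
rewrite (bigD1 i) //= B0 mul0r add0r -big_split /= big1 // => j /negPf ji.
by rewrite !mxE eq_sym ji mulr1 subrr.
Qed.

(** * Spectral pseudo-inverse of the Laplacian *)

Section pseudo_inverse.
Context {R : realType} {N : nat} {L : 'M[R]_N}.
Context {lam : 'I_N -> R} {u : 'I_N -> 'cV[R]_N}.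
Hypotheses (spec : laplacian_spectrum L lam u) (L_sym : L^T = L).

Let U : 'M[R]_N := \matrix_(i, a) u a i 0.

(* The zero mode drops out of the sum because [0^-1 = 0]. *)
Definition green : 'M[R]_N := \matrix_(i, j) \sum_a u a i 0 * u a j 0 / lam a.

Let U_orthogonal : U *m U^T = 1%:M.
Proof.
apply: mulmx1C; apply/matrixP => a c; rewrite !mxE.
by rewrite -(spectrum_orthonormal spec); apply: eq_bigr => i _; rewrite !mxE.
Qed.

Let conj_diagE (d : 'rV[R]_N) i j :
  (U *m diag_mx d *m U^T) i j = \sum_a u a i 0 * u a j 0 * d 0 a.
Proof.
rewrite mul_mx_diag mxE; apply: eq_bigr => a _; rewrite !mxE; ring.
Qed.

Let greenE : green = U *m diag_mx (\row_a (lam a)^-1) *m U^T.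
Proof.
apply/matrixP => i j; rewrite conj_diagE mxE.
by apply: eq_bigr => a _; rewrite mxE.
Qed.

Let spectralE : L = U *m diag_mx (\row_a lam a) *m U^T.
Proof.
rewrite -[LHS]mulmx1 -U_orthogonal mulmxA; congr (_ *m _).
apply/matrixP => i a; rewrite mul_mx_diag !mxE.
have /(congr1 (fun p : 'cV[R]_N => p i 0)) := spectrum_eigen spec a.
rewrite !mxE mulrC => <-; apply: eq_bigr => k _; by rewrite mxE.
Qed.

Lemma green_sym : green^T = green.
Proof.
apply/matrixP => i j; rewrite !mxE; apply: eq_bigr => a _.
by rewrite (mulrC (u a j 0)).
Qed.

Lemma eigenvalue_ge0 a : 0 <= lam a.
Proof.
have N0 : (0 < N)%N by apply: leq_ltn_trans (ltn_ord a).
pose z := Ordinal N0; rewrite -(spectrum_zero spec (a := z)) //.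
have [a0|a0] := posnP a; first by rewrite (_ : a = z) //; exact: val_inj.
by rewrite ltW // (spectrum_increasing spec).
Qed.

(** The spectrum increases strictly from 0, so the zero mode is simple. *)
Lemma eigenvalue_eq0 a : (lam a == 0) = (nat_of_ord a == 0%N).
Proof.
have N0 : (0 < N)%N by apply: leq_ltn_trans (ltn_ord a).
have [a0|a0] := posnP a; first by rewrite (spectrum_zero spec) // eqxx.
have := spectrum_increasing spec (a := Ordinal N0) (c := a) a0.
by rewrite (spectrum_zero spec (a := Ordinal N0)) // => /gt_eqF ->.
Qed.

Lemma bform_spectrum_ge0 p : 0 <= bform L p p.
Proof.
have -> : bform L p p = bform (diag_mx (\row_a lam a)) (U^T *m p) (U^T *m p).
  by rewrite /bform {1}spectralE trmx_mul trmxK !mulmxA.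
rewrite bformE sumr_ge0 // => a _.
rewrite mul_diag_mx !mxE mulrCA mulr_ge0 ?sqr_ge0 //; exact: eigenvalue_ge0.
Qed.

Hypothesis L_const : L *m const_mx 1 = 0 :> 'cV[R]_N.

(** Pairing the eigenvalue equation with the constant vector moves [L] onto that vector by symmetry,
    which gives 0. Eigenvectors of nonzero eigenvalue therefore have zero sum. *)
Let const_ortho a : lam a * (\sum_i u a i 0) = 0.
Proof.
have : (L *m u a)^T *m const_mx 1 = 0 :> 'cV[R]_1.
  by rewrite trmx_mul L_sym -mulmxA L_const mulmx0.
rewrite (spectrum_eigen spec) => /(congr1 (fun p : 'cV[R]_1 => p 0 0)).
rewrite mxE [RHS]mxE => H; rewrite -[RHS]H mulr_sumr; apply: eq_bigr => i _.
by rewrite !mxE mulr1.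
Qed.

(** In each mode either [lam a] vanishes, and with it its inverse by convention, or the eigenvector
    has zero sum. *)
Lemma green_const : green *m const_mx 1 = 0 :> 'cV[R]_N.
Proof.
apply/colP => i; rewrite !mxE.
under eq_bigr => j _ do rewrite !mxE mulr1.
rewrite exchange_big big1 //= => a _.
rewrite -mulr_suml -mulr_sumr -mulrA.
have /eqP := const_ortho a; rewrite mulf_eq0 => /orP[]/eqP ->.
  by rewrite invr0 !mulr0.
by rewrite mul0r mulr0.
Qed.

(** In eigencoordinates [L *m green] is the identity on all modes but the zero mode, and that one is
    parallel to the constants, hence absent from [p]. *)
Lemma mulmx_green (p : 'cV[R]_N) :
  (const_mx 1 : 'cV[R]_N)^T *m p = 0 -> L *m (green *m p) = p.
Proof.
move=> p0.
have UU : U^T *m U = 1%:M by exact: mulmx1C.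
rewrite {1}spectralE greenE !mulmxA -(mulmxA _ U^T U) UU mulmx1.
rewrite -[RHS]mul1mx -U_orthogonal -!mulmxA; congr (U *m _).
rewrite mulmxA mulmx_diag; set q := U^T *m p.
apply/colP => a; rewrite mul_diag_mx !mxE.
have [la0|la0] := eqVneq (lam a) 0; last by rewrite mulfV ?mul1r.
have U1 c : c != a -> (U^T *m (const_mx 1 : 'cV[R]_N)) c 0 = 0.
  move=> ca; rewrite mxE.
  have : lam c != 0.
    apply: contra ca; rewrite eigenvalue_eq0 => /eqP c0.
    move/eqP: la0; rewrite eigenvalue_eq0 => /eqP a0.
    by apply/eqP/val_inj; rewrite /= c0.
  move/mulfI; apply; rewrite mulr0 -[RHS](const_ortho c); congr (_ * _).
  by apply: eq_bigr => i _; rewrite !mxE mulr1.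
(* Otherwise the constant vector would be orthogonal to every eigenvector, hence zero. *)
have Ua : (U^T *m (const_mx 1 : 'cV[R]_N)) a 0 != 0.
  apply/eqP => Ua0.
  have : U *m (U^T *m (const_mx 1 : 'cV[R]_N)) = 0.
    apply/colP => i; rewrite mxE [RHS]mxE big1 // => c _.
    by have [->|/U1 ->] := eqVneq c a; rewrite ?Ua0 mulr0.
  rewrite mulmxA U_orthogonal mul1mx => /(congr1 (fun p : 'cV[R]_N => p a 0)).
  by rewrite !mxE => /eqP; rewrite oner_eq0.
rewrite la0 mul0r mul0r; apply/esym.
move/(congr1 (fun p : 'cV[R]_1 => p 0 0)): p0.
(* In eigencoordinates the zero sum of [p] reduces to a single product, whose first factor [Ua]
   makes nonzero; so the component of [p] on mode [a] vanishes. *)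
have -> : (const_mx 1 : 'cV[R]_N)^T *m p =
    (U^T *m (const_mx 1 : 'cV[R]_N))^T *m q.
  by rewrite trmx_mul trmxK /q mulmxA -(mulmxA _ U) U_orthogonal mulmx1.
rewrite mxE (bigD1 a) //= big1 => [|c /U1 Uc]; last first.
  by rewrite mxE Uc mul0r.
rewrite addr0 [X in X * _ = _]mxE [RHS]mxE => /eqP.
by rewrite mulf_eq0 (negPf Ua) => /eqP; rewrite mxE.
Qed.

Lemma bform_green_green (p : 'cV[R]_N) :
  (const_mx 1 : 'cV[R]_N)^T *m p = 0 ->
  bform L (green *m p) (green *m p) = bform green p p.
Proof.
move=> p0; rewrite (bformEr _ (mulmx_green p p0)) /bform.
by rewrite trmx_mul green_sym.
Qed.

End pseudo_inverse.

(** * Minimization of a linear function over the admissible parameters *)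

Section optimal_placement.
Context {R : realType} {N : nat}.

Lemma sorted_placement_perm (s : 'S_N) k :
  sorted_placement R s 0 (s k) =
    if (k < N./2)%N then 1 else if (N - N./2 <= k)%N then -1 else 0.
Proof. by rewrite mxE permK. Qed.

Lemma sorted_placement_admissible (s : 'S_N) :
  admissible (sorted_placement R s).
Proof.
split=> [i|].
  by rewrite mxE /=; do 2?case: ifP => _; rewrite ?lexx ?lerN10 ?ler01 ?lerN11 //; lra.
rewrite (reindex_inj (@perm_inj _ s)) /=.
(* Reversing the ranks negates the placement, so its sum equals its own opposite; the middle rank of
   an odd [N] is fixed and carries 0. *)
have rev k : sorted_placement R s 0 (s (rev_ord k)) =
    - sorted_placement R s 0 (s k).
  rewrite !sorted_placement_perm /= -divn2; have := ltn_ord k.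
  by do 4?case: ifP; rewrite ?oppr0 ?opprK //; lia.
set S := \sum_j _; suff : S = - S by lra.
rewrite {1}/S (reindex_inj rev_ord_inj) /S -sumrN.
by apply: eq_bigr => k _; rewrite rev.
Qed.

(* The marginal cost [rho] of the bus of middle rank separates the buses set
   to [1] from those set to [-1]; it serves as multiplier of the constraint
   that the parameters sum to zero. *)
Lemma sorted_placement_gap {rho : 'I_N -> R} {s : 'S_N} {k0 : 'I_N} {r} :
  sorts_ascending rho s -> nat_of_ord k0 = N./2 -> admissible r ->
  (forall k, 0 <= (rho (s k) - rho (s k0)) *
     (r 0 (s k) - sorted_placement R s 0 (s k))) /\
  \sum_i rho i * r 0 i - \sum_i rho i * sorted_placement R s 0 i =
  \sum_k (rho (s k) - rho (s k0)) *
     (r 0 (s k) - sorted_placement R s 0 (s k)).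
Proof.
move=> srt k0E [rb r0]; split=> [k|].
  rewrite sorted_placement_perm; have /andP[r1 r2] := rb (s k).
  case: ifP => kh.
    rewrite mulr_le0 // subr_le0 //; apply: srt; rewrite k0E; exact: ltnW.
  have h : rho (s k0) <= rho (s k) by apply: srt; rewrite k0E leqNgt kh.
  case: ifP => kh2; first by rewrite mulr_ge0 ?subr_ge0.
  (* A rank in neither half exists only for odd [N], where it is [N./2] itself. *)
  have -> : k = k0; last by rewrite subrr mul0r.
  apply: val_inj; rewrite /= k0E; move: kh kh2; rewrite -divn2; lia.
have [_ p0] := sorted_placement_admissible s.
rewrite -sumrB (reindex_inj (@perm_inj _ s)) /=; apply/eqP; rewrite -subr_eq0.
(* The two sides differ by the multiplier [rho (s k0)] times a difference of two sums that are both
   0. *)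
rewrite -sumrB; under eq_bigr => k _.
  have -> : rho (s k) * r 0 (s k) - rho (s k) * sorted_placement R s 0 (s k) -
   (rho (s k) - rho (s k0)) * (r 0 (s k) - sorted_placement R s 0 (s k)) =
   rho (s k0) * (r 0 (s k) - sorted_placement R s 0 (s k)) by ring.
  over.
rewrite -mulr_sumr sumrB.
rewrite -(reindex_inj perm_inj (P := xpredT) (F := fun i => r 0 i)) r0.
rewrite -(reindex_inj perm_inj (P := xpredT) (F := fun i => sorted_placement R s 0 i)).
by rewrite p0 subrr mulr0.
Qed.

Lemma sorted_placement_minimizer (M0 : R) (rho : 'I_N -> R) (s : 'S_N) :
  sorts_ascending rho s ->
  is_minimizer (@admissible R N) (linear_measure M0 rho) (sorted_placement R s).
Proof.
move=> srt; split; first exact: sorted_placement_admissible.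
move=> r adm; rewrite lerD2l.
(* Without buses there is no middle rank, but then both sums are empty. *)
have [N0|N0] := posnP N.
  by rewrite !big1 // => i; exfalso; have := ltn_ord i; lia.
have hN : (N./2 < N)%N by rewrite -divn2 ltn_Pdiv.
have [gap0 gapE] :=
  sorted_placement_gap srt (erefl : nat_of_ord (Ordinal hN) = N./2) adm.
by rewrite -subr_ge0 gapE sumr_ge0.
Qed.

(** A second minimizer makes the gap, a sum of nonnegative terms, vanish term by term. Distinct
    sensitivities then fix every rank except the middle one, which the zero-sum constraint
    determines. *)
Lemma sorted_placement_unique (M0 : R) (rho : 'I_N -> R) (s : 'S_N) r :
  sorts_ascending rho s -> injective rho ->
  is_minimizer (@admissible R N) (linear_measure M0 rho) r ->
  r = sorted_placement R s.
Proof.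
move=> srt rho_inj [adm rmin]; apply/rowP => i.
have hN : (N./2 < N)%N by rewrite -divn2 ltn_Pdiv // (leq_ltn_trans _ (ltn_ord i)).
pose k0 := Ordinal hN.
have [gap0 gapE] := sorted_placement_gap srt (erefl : nat_of_ord k0 = N./2) adm.
have := rmin _ (sorted_placement_admissible s).
rewrite lerD2l -subr_le0 gapE => gap_le0.
have eq_off k : k != k0 -> r 0 (s k) = sorted_placement R s 0 (s k).
  move=> kk0; apply/eqP; rewrite -subr_eq0.
  have /eqP : \sum_k (rho (s k) - rho (s k0)) *
     (r 0 (s k) - sorted_placement R s 0 (s k)) = 0.
    by apply/eqP; rewrite eq_le gap_le0 sumr_ge0.
  rewrite psumr_eq0 // => /allP /(_ k (mem_index_enum _)) /=.
  rewrite mulf_eq0 => /orP[/eqP/subr0_eq H|//].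
  by move: kk0; rewrite (perm_inj (rho_inj _ _ H)) eqxx.
rewrite -(permKV s i); have [->|/eq_off //] := eqVneq ((s^-1)%g i) k0.
have [_ r0] := adm; have [_ p0] := sorted_placement_admissible s.
move: (etrans r0 (esym p0)).
rewrite (reindex_inj (@perm_inj _ s)) [RHS](reindex_inj (@perm_inj _ s)) /=.
rewrite (bigD1 k0) //= [RHS](bigD1 k0) //=.
by rewrite (eq_bigr _ (fun k => eq_off k)) => /addIr.
Qed.

End optimal_placement.

(** * Closed form of the measure and its expansion in the inertias *)

Section inertia_expansion.
Context {R : realType} {N : nat} {L : 'M[R]_N}.
Context {lam : 'I_N -> R} {u : 'I_N -> 'cV[R]_N} {b : 'I_N} {dP gam m : R}.
Context {th om : 'rV[R]_N -> 'rV[R]_N -> R -> 'cV[R]_N}.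
Hypotheses (spec : laplacian_spectrum L lam u) (L_sym : L^T = L)
  (L_const : L *m const_mx 1 = 0 :> 'cV[R]_N).
Hypotheses (gam_gt0 : 0 < gam) (m_gt0 : 0 < m).
Hypothesis sol : forall mass damp : 'rV[R]_N,
  feasible_parameters gam mass damp ->
  swing_solution mass damp L (power_loss b dP) (th mass damp) (om mass damp).

Let G : 'M[R]_N := @green R N lam u.
Let one : 'cV[R]_N := const_mx 1.
Let K := dP ^+ 2 / (2 * gam).
Local Notation feasible dm r :=
  (feasible_parameters gam (inertia m dm r) (damping gam m dm r)).

Let N_gt0 : 0 < N%:R :> R.
Proof. by rewrite ltr0n (leq_ltn_trans _ (ltn_ord b)). Qed.

Let G_sym : G^T = G := green_sym.

Let G_one p : bform G p one = 0.
Proof. by rewrite (bformEr _ (green_const spec L_sym L_const)) mulmx0 mxE. Qed.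

Let bform_delta i p : bform G (delta_mx i 0) p = (G *m p) i 0.
Proof.
rewrite bformE (bigD1 i) //= big1 => [|j /negPf ji]; last first.
  by rewrite mxE ji mul0r.
by rewrite mxE !eqxx mul1r addr0.
Qed.

Let mulmx_delta (A : 'M[R]_N) i j : (A *m (delta_mx j 0 : 'cV_N)) i 0 = A i j.
Proof.
rewrite mxE (bigD1 j) //= big1 => [|k /negPf kj].
  by rewrite mxE !eqxx mulr1 addr0.
by rewrite mxE kj mulr0.
Qed.

Lemma sensitivityE mu i :
  sensitivity lam u b dP gam mu i = - (mu * dP ^+ 2 / (gam * N%:R)) * G b i.
Proof.
rewrite /sensitivity mxE big_mkcond /=; congr (_ * _).
apply: eq_bigr => a _; case: posnP => // a0.
by rewrite (spectrum_zero spec) // invr0 mulr0.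
Qed.

Lemma feasible_small dm (r : 'rV[R]_N) :
  `|dm| < m -> (forall i, `|r 0 i| <= 1) -> feasible dm r.
Proof.
move=> dm_m r1.
have mass0 i : 0 < m + dm * r 0 i.
  have : `|dm * r 0 i| < m.
    by rewrite (le_lt_trans _ dm_m) // normrM ler_piMr.
  by rewrite ltr_norml => /andP[]; lra.
split=> i; rewrite !mxE //.
by rewrite mulfK // gt_eqF.
Qed.

(** Here [c] is [dm] over the total inertia. The sum of [r] is kept arbitrary because partial
    derivatives leave the hyperplane of zero-sum parameters. *)
Lemma Mb_expansion dm (r : 'rV[R]_N) : feasible dm r ->
  let c := dm / (N%:R * m + dm * \sum_i r 0 i) in
  Mb om gam m dm r = (K * (G b b - 2 * c * (\sum_i G b i * r 0 i) +
    c ^+ 2 * bform G r^T r^T))%:E.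
Proof.
move=> fe c; have [mass0 _] := fe; set mass := inertia m dm r.
have totalE : \sum_i mass 0 i = N%:R * m + dm * \sum_i r 0 i.
  under eq_bigr do rewrite mxE.
  by rewrite big_split /= -mulr_sumr sumr_const card_ord mulr_natl.
have total0 : 0 < \sum_i mass 0 i.
  by rewrite (bigD1 b) //= ltr_wpDr // sumr_ge0 // => i _; exact: ltW.
pose q : 'cV[R]_N := force_centering mass *m delta_mx b 0.
have q0 : one^T *m q = 0 by rewrite mulmxA one_force_centering // mul0mx.
have damp_mass : damping gam m dm r = gam *: mass.
  by apply/rowP => i; rewrite !mxE.
rewrite /Mb (perf_measure_swing mass mass0 gam dP b L _ _ _ (G *m q) gam_gt0
  damp_mass L_sym (bform_spectrum_ge0 spec) L_const _ (sol _ _ fe)); last first.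
  exact: (mulmx_green spec).
rewrite (bform_green_green spec L_sym L_const) // -/G; congr EFin.
(* The centred unit force is split into the unit force, a multiple of [r] and a constant vector; the
   form of [G] annihilates every term containing the last. *)
have -> : q = delta_mx b 0 + - c *: r^T + - (m / \sum_i mass 0 i) *: one.
  apply/colP => i.
  rewrite /q mulmxBl mul1mx -scalemxAl -mulmxA /c -totalE.
  have -> : one^T *m delta_mx b 0 = 1%:M :> 'M[R]_1.
    apply/matrixP => j k; rewrite !ord1 !mxE (bigD1 b) //= big1 => [|l /negPf lb].
      by rewrite !mxE !eqxx mulr1 addr0.
    by rewrite !mxE lb mulr0.
  rewrite mulmx1 !mxE; field; rewrite gt_eqF //.
rewrite !(bformDl, bformDr, bformZl, bformZr) !G_one.
rewrite (bform_sym one _ G_sym) (bform_sym one r^T G_sym) !G_one.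
rewrite (bform_sym r^T (delta_mx b 0) G_sym) !bform_delta.
rewrite mulmx_delta.
have -> : (G *m r^T) b 0 = \sum_i G b i * r 0 i.
  by rewrite mxE; apply: eq_bigr => i _; rewrite [r^T _ _]mxE.
by rewrite /K; field; rewrite !gt_eqF.
Qed.

Lemma Mb_homogeneous dm : `|dm| < m -> fine (Mb om gam m dm 0) = K * G b b.
Proof.
move=> dm_m; rewrite Mb_expansion => [/=|]; last first.
  by apply: feasible_small => // i; rewrite mxE normr0.
rewrite big1 => [|i _]; last by rewrite mxE.
rewrite big1 => [|i _]; last by rewrite [X in _ * X]mxE mulr0.
by rewrite trmx0 -(scale0r one) bformZl mul0r !mulr0 subr0 addr0.
Qed.

Lemma Mb_delta dm i h : `|dm| < m -> `|h| <= 1 ->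
  let c := dm / (N%:R * m + dm * h) in
  fine (Mb om gam m dm (h *: delta_mx 0 i)) =
    K * (G b b - 2 * c * (h * G b i) + c ^+ 2 * (h ^+ 2 * G i i)).
Proof.
move=> dm_m h1 c; have deltaE j : (h *: delta_mx 0 i : 'rV_N) 0 j = h * (j == i)%:R.
  by rewrite !mxE eqxx.
have sum_delta (F : 'I_N -> R) :
    \sum_j F j * (h *: delta_mx 0 i : 'rV_N) 0 j = h * F i.
  rewrite (bigD1 i) //= big1 => [|j /negPf ji]; last by rewrite deltaE ji !mulr0.
  by rewrite deltaE eqxx mulr1 addr0 mulrC.
rewrite Mb_expansion => [/=|]; last first.
  apply: feasible_small => // j; rewrite deltaE normrM.
  by case: eqP => _; rewrite ?normr1 ?normr0 ?mulr1 ?mulr0.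
have -> : \sum_j (h *: delta_mx 0 i : 'rV_N) 0 j = h.
  by rewrite -[RHS]mulr1 -sum_delta; apply: eq_bigr => j _; rewrite mul1r.
rewrite sum_delta.
have -> : (h *: delta_mx 0 i : 'rV_N)^T = h *: delta_mx i 0.
  by apply/colP => j; rewrite !mxE andbC.
rewrite bformZl bformZr bform_delta mulmx_delta.
by rewrite -/c (expr2 h) -(mulrA h h).
Qed.

Lemma Mb_partial_derivative dm i : `|dm| < m ->
  is_derive (0 : 'rV[R]_N) (delta_mx 0 i : 'rV[R]_N)
    (fun r => fine (Mb om gam m dm r)) (sensitivity lam u b dP gam (dm / m) i).
Proof.
move=> dm_m; set f := fun r => _; set l := sensitivity _ _ _ _ _ _ _.
suff H : h^-1 *: ((f \o shift 0) (h *: delta_mx 0 i) - f 0) @[h --> 0^'] --> l.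
  by apply: DeriveDef; [exact: (cvgP l)|exact: cvg_lim].
pose c (h : R) := dm / (N%:R * m + dm * h).
(* The sensitivity is written as the value at 0 of the difference quotient, the vanishing quadratic
   term being kept so that the limit matches term by term. *)
have -> : l = K * (- (2 * c 0 * G b i) + c 0 ^+ 2 * 0 * G i i).
  rewrite /l sensitivityE /K /c; field.
  by rewrite !gt_eqF.
have Nm0 : N%:R * m + dm * 0 != 0 by rewrite mulr0 addr0 mulf_neq0 // gt_eqF.
have h_cvg : h @[h --> (0:R)^'] --> (0:R) by exact: nbhs_dnbhs.
have c_cvg : c h @[h --> 0^'] --> c 0.
  apply: cvgM; first exact: cvg_cst.
  apply: cvgV => //; apply: cvgD; first exact: cvg_cst.
  by apply: cvgM => //; exact: cvg_cst.
have lim : K * (- (2 * c h * G b i) + c h ^+ 2 * h * G i i) @[h --> 0^'] -->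
    K * (- (2 * c 0 * G b i) + c 0 ^+ 2 * 0 * G i i).
  apply: cvgM; first exact: cvg_cst.
  apply: cvgD.
    apply: cvgN; apply: cvgM; last exact: cvg_cst.
    by apply: cvgM => //; exact: cvg_cst.
  apply: cvgM; last exact: cvg_cst.
  by apply: cvgM => //; apply: cvgM.
apply: cvg_trans lim; apply: near_eq_cvg; near=> h.
have h0 : h != 0 by near: h; exact: nbhs_dnbhs_neq.
have h1 : `|h| <= 1.
  by apply: ltW; near: h; apply: dnbhs0_lt.
rewrite /= addr0 /f Mb_delta // Mb_homogeneous // -/(c h) /GRing.scale /=.
by field.
Unshelve. all: by end_near. Qed.

(** For zero-sum [r] the total inertia is constant, so the measure is exactly quadratic in [dm / m].
    The remainder is the quadratic term, bounded entrywise using that each parameter has modulus at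
    most 1. *)
Lemma Mb_remainder dm r : `|dm| < m -> admissible r ->
  `|fine (Mb om gam m dm r) - linear_measure (fine (Mb om gam m dm 0))
     (sensitivity lam u b dP gam (dm / m)) r| <=
  K * (\sum_i \sum_j `|G i j|) / N%:R ^+ 2 * (dm / m) ^+ 2.
Proof.
move=> dm_m [rb r0]; have r1 i : `|r 0 i| <= 1 by rewrite ler_norml.
rewrite Mb_expansion => [/=|]; last exact: feasible_small.
rewrite /linear_measure Mb_homogeneous // r0 mulr0 addr0.
set S := \sum_i G b i * r 0 i.
have -> : \sum_i sensitivity lam u b dP gam (dm / m) i * r 0 i =
    - (dm / m * dP ^+ 2 / (gam * N%:R)) * S.
  by rewrite mulr_sumr; apply: eq_bigr => i _; rewrite sensitivityE; ring.
set Q := bform G _ _.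
have -> : K * (G b b - 2 * (dm / (N%:R * m)) * S + (dm / (N%:R * m)) ^+ 2 * Q) -
    (K * G b b + - (dm / m * dP ^+ 2 / (gam * N%:R)) * S) =
    K * Q / N%:R ^+ 2 * (dm / m) ^+ 2.
  by rewrite /K; field; rewrite !gt_eqF.
have w0 : 0 <= K / N%:R ^+ 2 * (dm / m) ^+ 2.
  by rewrite mulr_ge0 ?sqr_ge0 // !divr_ge0 ?sqr_ge0 // mulr_ge0 // ltW.
have factor x : K * x / N%:R ^+ 2 * (dm / m) ^+ 2 =
    x * (K / N%:R ^+ 2 * (dm / m) ^+ 2) by ring.
rewrite !factor normrM (ger0_norm w0) ler_wpM2r // /Q bformE.
apply: le_trans (ler_norm_sum _ _ _) _; apply: ler_sum => i _.
rewrite normrM [r^T _ _]mxE (le_trans (ler_piMl _ _)) // mxE.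
rewrite (le_trans (ler_norm_sum _ _ _)) //.
by apply: ler_sum => j _; rewrite normrM [r^T _ _]mxE ler_piMr.
Qed.

End inertia_expansion.

Theorem theorem1 (R : realType) (N : nat)
    (B : 'M[R]_N) (P0 th0 : 'cV[R]_N)
    (lam : 'I_N -> R) (u : 'I_N -> 'cV[R]_N)
    (b : 'I_N) (dP gam m : R)
    (th om : 'rV[R]_N -> 'rV[R]_N -> R -> 'cV[R]_N)
    (hgrid : stationary_grid B P0 th0)
    (hspec : laplacian_spectrum (laplacian B th0) lam u)
    (hgam : 0 < gam) (hm : 0 < m)
    (hsol : forall mass damp : 'rV[R]_N, feasible_parameters gam mass damp ->
       swing_solution mass damp (laplacian B th0) (power_loss b dP)
         (th mass damp) (om mass damp)) :
  let M (dm : R) (r : 'rV[R]_N) : \bar R := Mb om gam m dm r in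
  let rho (dm : R) : 'I_N -> R := sensitivity lam u b dP gam (dm / m) in
  let Mlin (dm : R) : 'rV[R]_N -> R :=
    linear_measure (fine (M dm 0)) (rho dm) in
  [/\ (* the measure is finite *)
      forall (dm : R) (r : 'rV[R]_N),
        feasible_parameters gam (inertia m dm r) (damping gam m dm r) ->
        M dm r \is a fin_num,
      (* (1) rho_i is the partial derivative of M_b with respect to r_i *)
      forall (dm : R) (i : 'I_N), `|dm| < m ->
        is_derive (0 : 'rV[R]_N) (delta_mx 0 i : 'rV[R]_N)
          (fun r => fine (M dm r)) (rho dm i),
      (* first-order expansion, with an O(mu^2) remainder, mu = dm / m *)
      exists C : R, \forall dm \near (0 : R),
        forall r : 'rV[R]_N, admissible r ->
          `|fine (M dm r) - Mlin dm r| <= C * (dm / m) ^+ 2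
    & (* (2)-(3) the optimal placement *)
      forall (dm : R) (s : 'S_N), `|dm| < m -> sorts_ascending (rho dm) s ->
        let r := sorted_placement R s in
        [/\ is_minimizer (@admissible R N) (Mlin dm) r,
            injective (rho dm) ->
              forall r', is_minimizer (@admissible R N) (Mlin dm) r' -> r' = r
          & feasible_parameters gam (inertia m dm r) (damping gam m dm r)]].
Proof.
move=> M rho Mlin.
have L_sym := laplacian_sym _ _ _ _ _ hgrid.
have L_const := laplacian_const _ _ _ _ _ hgrid.
split.
- by move=> dm r fe; rewrite /M (Mb_expansion hspec L_sym L_const hgam hsol).
- by move=> dm i; apply: (Mb_partial_derivative hspec L_sym L_const hgam hm hsol).
(* This is the constant of [Mb_remainder], independent of [dm] and [r]; nearness to 0 only serves to
   ensure [|dm| < m]. *)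
- exists (dP ^+ 2 / (2 * gam) *
    (\sum_i \sum_j `|@green R N lam u i j|) / N%:R ^+ 2).
  near=> dm; have dm_m : `|dm| < m by near: dm; exact: (@nbhs0_lt R R).
  by move=> r; exact: (Mb_remainder hspec L_sym L_const hgam hm hsol).
- move=> dm s dm_m srt r; split.
  + exact: sorted_placement_minimizer.
  + by move=> rho_inj r'; exact: sorted_placement_unique.
  + apply: feasible_small => // i; rewrite ler_norml.
    by have [-> _] := @sorted_placement_admissible R N s.
Unshelve. all: by end_near. Qed.
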